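(* Let $n$ be a positive integer and let $\mathcal{P}(2,n)\subseteq\mathbb{R}^2$ be the convex hull of all words $u_1u_2$ with entries in $\{0,1,\ldots,n\}$ whose nonzero entries are distinct. Then $\mathcal{P}(2,n)$ has normalized volume $2n^2-1$.
   Context: The normalized volume of a $d$-dimensional polytope is $d!$ times its $d$-dimensional Euclidean volume; here $d=2$. *)

(* Defs.v *)
From HB Require Import structures.
From mathcomp Require Export all_boot all_order all_algebra.
From mathcomp Require Export all_classical all_reals all_analysis.
Export Order.TTheory GRing.Theory Num.Theory.
Export numFieldNormedType.Exports.

Set Implicit Arguments.
Unset Strict Implicit.
Unset Printing Implicit Defensive.

Local Open Scope classical_set_scope.
Local Open Scope ring_scope.

Definition convex_hull (R : numDomainType) (M : lmodType R) (A : set M) :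
  set M := smallest (@convex_set R M) A.

(* Zero may be repeated; every other letter occurs at most once. *)
Definition distinct_nonzero (m n : nat) (u : m.-tuple 'I_n.+1) : bool :=
  uniq [seq x <- u | x != ord0].

Definition word_point (R : realType) (n : nat) (u : 2.-tuple 'I_n.+1) : R * R :=
  (((tnth u ord0 : nat)%:R : R), ((tnth u ord_max : nat)%:R : R)).

Definition polytope2 (R : realType) (n : nat) : set (R * R) :=
  @convex_hull R (R * R)%type
    (@word_point R n @` [set u | distinct_nonzero u]).
Arguments polytope2 : clear implicits.

(* 2! times the planar Lebesgue measure; the outer scaling is in \bar R. *)
Definition normalized_area (R : realType) (A : set (R * R)) : \bar R :=
  ((2`!)%:R%:E * (@lebesgue_measure R \x @lebesgue_measure R) A)%E.

(* Main.v *)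
(** The hull is the square [0, n]^2 with the corner beyond the line
    x + y = 2n - 1 cut off, because (n, n) is the only point of {0,...,n}^2 with
    x + y >= 2n and it is not a distinct word, while the vertices (0, 0), (n, 0),
    (0, n), (n, n-1), (n-1, n) are. The corner is a right triangle with unit legs,
    so the area is n^2 - 1/2. *)

From mathcomp Require Import zify ring lra measurable_realfun.
Require Import Defs.

Local Open Scope classical_set_scope.
Local Open Scope ring_scope.

Definition truncated_square {R : realType} (a : R) : set (R * R) :=
  [set p | [/\ 0 <= p.1 <= a, 0 <= p.2 <= a & p.1 + p.2 <= 2 * a - 1]].

(** Unpacks [convex_set], whose weights are bundled elements of the unit interval, into coordinates
    with a plain real weight. *)
Lemma convex_segment {R : realType} {C : set (R * R)} (p q : R * R) (t : R) :
  @convex_set R (R * R)%type C -> C p -> C q -> 0 <= t <= 1 ->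
  C (t * p.1 + (1 - t) * q.1, t * p.2 + (1 - t) * q.2).
Proof.
move=> cC Cp Cq t01.
have kt : Itv.spec (@Itv.num_sem R) (Itv.Real `[0%Z, 1%Z]) t.
  by rewrite /= /Itv.num_sem/= in_itv/= t01 andbT num_real.
have := cC p q (Itv.mk kt) (mem_set Cp) (mem_set Cq).
by move/set_mem.
Qed.

Lemma convex_horizontal {R : realType} {C : set (R * R)} (a b x y : R) :
  @convex_set R (R * R)%type C -> C (a, y) -> C (b, y) -> a <= x <= b ->
  C (x, y).
Proof.
move=> cC Ca Cb /andP[ax xb].
(* The weight of the left endpoint will be [(b - x) / (b - a)], so the degenerate segment is treated
   apart. *)
have [ab|ab] := ltP a b; last by have -> : x = a by lra.
have := convex_segment (a, y) (b, y) ((b - x) / (b - a)) cC Ca Cb.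
rewrite /= divr_ge0 ?ler_pdivrMr//=; [|lra..].
set t := _ / _ => /(_ ltac:(lra)).
have tE : t * (b - a) = b - x by rewrite /t divfK// subr_eq0; lra.
suff [-> ->] : t * a + (1 - t) * b = x /\ t * y + (1 - t) * y = y by [].
by split; nra.
Qed.

Lemma convex_vertical {R : realType} {C : set (R * R)} (a b x y : R) :
  @convex_set R (R * R)%type C -> C (x, a) -> C (x, b) -> a <= y <= b ->
  C (x, y).
Proof.
move=> cC Ca Cb /andP[ay yb].
have [ab|ab] := ltP a b; last by have -> : y = a by lra.
have := convex_segment (x, a) (x, b) ((b - y) / (b - a)) cC Ca Cb.
rewrite /= divr_ge0 ?ler_pdivrMr//=; [|lra..].
set t := _ / _ => /(_ ltac:(lra)).
have tE : t * (b - a) = b - y by rewrite /t divfK// subr_eq0; lra.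
suff [-> ->] : t * x + (1 - t) * x = x /\ t * a + (1 - t) * b = y by [].
by split; nra.
Qed.

Lemma convex_truncated_square (R : realType) (a : R) :
  @convex_set R (R * R)%type (truncated_square a).
Proof.
move=> [x1 x2] [y1 y2] l /set_mem[/= ? ? ?] /set_mem[/= ? ? ?].
apply/mem_set; rewrite /truncated_square/=.
have : 0 <= l%:num <= 1 by apply/andP; split.
rewrite /conv/= /GRing.scale/= /unstable.onem; set t := l%:num => ?.
by split; nra.
Qed.

Lemma word_in_polytope2 (R : realType) (n i j : nat) :
  (i <= n)%N -> (j <= n)%N -> ((i != j) || (i == 0)%N) ->
  polytope2 R n (i%:R, j%:R).
Proof.
move=> le_in le_jn ij.
apply: sub_gen_smallest; exists [tuple inord i; inord j].
  rewrite /= /distinct_nonzero/=.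
  have inord0 k : (k <= n)%N -> (inord k != ord0 :> 'I_n.+1) = (k != 0)%N.
    by move=> kn; rewrite -val_eqE/= inordK.
  (* Equal letters must both be 0, and then the filtered word is empty. *)
  rewrite !inord0//; case: eqVneq ij => [<-|ij _]; first by move=> /= /eqP ->.
  case: ifP => _ //; case: ifP => _ //=.
  by rewrite !inE andbT -val_eqE/= !inordK.
rewrite /word_point/tnth/= !inordK//.
Qed.

Lemma polytope2E (R : realType) (n : nat) : (0 < n)%N ->
  polytope2 R n = truncated_square n%:R.
Proof.
move=> n0; apply/seteqP; split.
  apply: smallest_sub; first exact: convex_truncated_square.
  move=> _ [u du <-]; rewrite /truncated_square /word_point/=.
  have u0 := ltn_ord (tnth u ord0); have u1 := ltn_ord (tnth u ord_max).
  (* Two distinct letters sum to at most [n + (n - 1)]. If a letter is 0, the sum is at most [n],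
     which is within the bound because [n] is positive. *)
  have u2 : (tnth u ord0 + tnth u ord_max <= 2 * n - 1)%N.
    move: du u0 u1; rewrite /distinct_nonzero.
    case: u => -[|a [|b []]]//= ?; rewrite /tnth/=.
    rewrite -!(val_eqE _ ord0)/=.
    case: ifP => [a0|/eqP a0]; case: ifP => [b0|/eqP b0]//=; try by lia.
    by rewrite inE -val_eqE/= andbT; lia.
  split; rewrite ?ler0n/= ?ler_nat//.
  move: u2; rewrite -(ler_nat R) natrD natrB ?natrM//; lia.
(* Conversely, the point must lie in every convex [C] containing the words; it is reached from the
   five vertices by segments parallel to the axes and one slanted segment. *)
case=> x y [/= x0n y0n xy] C [cC genC].
have n1E : (n.-1%:R : R) = n%:R - 1 by rewrite -subn1 natrB.
have CP i j : (i <= n)%N -> (j <= n)%N -> (i != j) || (i == 0)%N ->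
    C (i%:R, j%:R).
  by move=> *; apply: (@word_in_polytope2 R n i j).
have le1 : (n.-1 <= n)%N by rewrite leq_pred.
have P00 := CP 0 0 (leq0n n) (leq0n n) (orbT _).
have Pn0 := CP n 0 (leqnn n) (leq0n n) ltac:(lia).
have P0n := CP 0 n (leq0n n) (leqnn n) ltac:(lia).
have Pn1 := CP n n.-1 (leqnn n) le1 ltac:(lia).
have P1n := CP n.-1 n le1 (leqnn n) ltac:(lia).
rewrite n1E in Pn1 P1n.
have Px0 : C (x, 0) by apply: (convex_horizontal 0 n%:R).
(* The vertical slice at [x] ends on the top edge [y = n] up to [x = n - 1], and on the slanted edge
   from there on. *)
have [xn|nx] := leP x (n%:R - 1).
  apply: (convex_vertical 0 n%:R) => //.
  by apply: (convex_horizontal 0 (n%:R - 1)) => //; lra.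
apply: (convex_vertical 0 (2 * n%:R - 1 - x)) => //; last lra.
(* The slanted edge has unit width, so weight [n - x] on its left end gives abscissa [x]. *)
have := convex_segment (n%:R - 1, n%:R) (n%:R, n%:R - 1) (n%:R - x) cC P1n Pn1.
rewrite /=; set u := (_, _) => /(_ ltac:(lra)).
by congr C; rewrite /u; congr pair; lra.
Qed.

(** Integrates the slice lengths [f x]: they equal [a] on [[0, a - 1]] and fall linearly on
    [[a - 1, a]]. The bound on [a] puts the breakpoint in range. *)
Lemma lebesgue_measure_truncated_square (R : realType) (a : R) : 1 <= a ->
  ((@lebesgue_measure R \x @lebesgue_measure R) (truncated_square a) =
  (a ^+ 2 - 2^-1)%:E)%E.
Proof.
move=> a1.
rewrite /product_measure1.
pose f x := Num.min a (2 * a - 1 - x).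
have E : (fun x => (lebesgue_measure \o xsection (truncated_square a)) x) =
    (EFin \o f) \_ `[0, a]%classic.
  apply/funext => x; rewrite /patch/=.
  rewrite mem_setE /xsection in_itv/=; case: ifPn => x0a.
    rewrite [X in lebesgue_measure X](_ : _ = `[0, f x]%classic).
      (* The interval formula returns 0 unless [0 < f x]; this agrees with [f x], which is
         nonnegative on [[0, a]]. *)
      rewrite lebesgue_measure_itv/= lte_fin; case: ltP => f0; rewrite ?sube0//.
      have fx0 : 0 <= f x by rewrite /f le_min; lra.
      by congr EFin; apply/le_anti; rewrite fx0 f0.
    apply/seteqP; split => y/=; rewrite inE in_itv/= /f le_min.
      by move=> [/=]; lra.
    by move=> h; split => /=; lra.
  rewrite [X in lebesgue_measure X](_ : _ = set0) ?measure0//.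
  by rewrite -subset0 => y /=; rewrite inE => -[/=]; rewrite (negbTE x0a).
rewrite E -integral_mkcond.
have a10 : 0 <= a - 1 by rewrite subr_ge0.
have mf (D : set (measurableTypeR R)) :
    measurable_fun D (EFin \o f : measurableTypeR R -> \bar R).
  apply/measurable_EFinP; apply: measurable_minr => //.
  by apply: measurable_funB => //; exact: measurable_cst.
rewrite (@itv_bndbnd_setU _ _ _ (BRight (a - 1)))/= ?bnd_simp//; last by lra.
rewrite integral_setU//=; last first.
  by apply/disj_setPS => y [/=]; rewrite !in_itv/= => /andP[_ ?] /andP[]; lra.
(* Adding the null endpoint [a - 1] gives the closed interval needed for the fundamental theorem of
   calculus. *)
rewrite integral_itv_obnd_cbnd; last exact: mf.
rewrite (eq_integral (cst a%:E)); last first.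
  move=> x /set_mem; rewrite /= in_itv/= => ?.
  by congr EFin; apply/min_idPl; lra.
rewrite integral_cst//= lebesgue_measure_itv/= lte_fin.
(* [F] is a primitive of [g], the linear branch of [f]. *)
pose F x : R := (2 * a - 1) * x - 2^-1 * x ^+ 2.
pose g x : R := 2 * a - 1 - x.
have dF (x : R) : is_derive x 1 F (g x).
  rewrite /F; apply: is_derive_eq; rewrite /g /GRing.scale/=.
  by field.
have cF (x : R) : {for x, continuous F}.
  by apply/differentiable_continuous/derivable1_diffP; apply: ex_derive.
rewrite (@eq_integral _ (measurableTypeR R) _ _ _ (fun x => (g x)%:E)); last first.
  move=> x /set_mem; rewrite /= in_itv/= => ?.
  by congr EFin; apply/min_idPr; rewrite /g; lra.
rewrite (@continuous_FTC2 _ g F); first last.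
- by move=> x _; rewrite derive1E; exact: derive_val.
- split=> [x _||]; first exact: ex_derive.
  + by apply: cvg_at_right_filter; exact: cF.
  + by apply: cvg_at_left_filter; exact: cF.
- by apply: continuous_subspaceT => x; apply: cvgB; [exact: cvg_cst|exact: cvg_id].
- by lra.
(* For [a = 1] the first interval is a point, and the default 0 is again [a - 1]. *)
have -> : (if (0 < a - 1)%R then (a - 1)%:E + (- 0)%:E else 0 : \bar R)%E =
    (a - 1)%:E.
  by rewrite oppr0 adde0; case: ltP => // ?; congr EFin; lra.
(* The two pieces contribute [a * (a - 1)] and [a - 1/2]. *)
by rewrite -EFinM -EFinB -EFinD /F; congr EFin; field.
Qed.

Theorem theorem5p27 (R : realType) (n : nat) (hn : (0 < n)%N) :
  normalized_area (polytope2 R n) = (2%:R * n%:R ^+ 2 - 1)%:E.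
Proof.
rewrite /normalized_area polytope2E// lebesgue_measure_truncated_square ?ler1n//.
by rewrite -EFinM; congr EFin; rewrite mulrBr divff// pnatr_eq0.
Qed.
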